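(* (1) If $\Gamma\vdash M\Uparrow A$ in the simply-typed $\lambda$-calculus over $\Sigma$, then $\Gamma^+;\cdot;\cdot\vdash M^-\Uparrow A^-$ in the strict $\lambda$-calculus over $\Sigma^+$. (2) If $\Gamma\vdash M\downarrow A$, then $\Gamma^+;\cdot;\cdot\vdash M^+\downarrow A^+$.
   Context: Simply-typed $\lambda$-calculus: types $A::=a\mid A_1\to A_2$, terms $c\mid x\mid\lambda x{:}A.M\mid MN$, plus existential variables $E_A$. Canonical/atomic judgments: $c{:}A\in\Sigma$ gives $\Gamma\vdash c\downarrow A$; $x{:}A\in\Gamma$ gives $\Gamma\vdash x\downarrow A$; $\Gamma\vdash M\downarrow a$ gives $\Gamma\vdash M\Uparrow a$ ($a$ atomic); $(\Gamma,x{:}A)\vdash M\Uparrow B$ gives $\Gamma\vdash\lambda x{:}A.M\Uparrow A\to B$; $\Gamma\vdash M\downarrow A\to B$ and $\Gamma\vdash N\Uparrow A$ give $\Gamma\vdash MN\downarrow B$; and $\Gamma\vdash E_A\,x_1\dots x_n\Uparrow a$ whenever $A=A_1\to\cdots\to A_n\to a$ and $x_1,\dots,x_n$ are distinct with $x_i{:}A_i\in\Gamma$. Strict $\lambda$-calculus: labels $k\in\{1,0,u\}$, types $A::=a\mid A_1\to^kA_2$, terms $c\mid x\mid\lambda x^k{:}A.M\mid M_1M_2^k$. Canonical/atomic judgments $\Gamma;\Omega;\Delta\vdash M\Uparrow A$ / $\downarrow A$ ($\Gamma$ unrestricted, $\Omega$ irrelevant, $\Delta$ strict, disjoint; commas are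 disjoint unions): $c{:}A\in\Sigma$ gives $\Gamma;\Omega;\cdot\vdash c\downarrow A$; $(\Gamma,x{:}A);\Omega;\cdot\vdash x\downarrow A$; $\Gamma;\Omega;x{:}A\vdash x\downarrow A$; $M\downarrow a$ gives $M\Uparrow a$; from $(\Gamma,x{:}A);\Omega;\Delta\vdash M\Uparrow B$ infer $\Gamma;\Omega;\Delta\vdash\lambda x^u{:}A.M\Uparrow A\to^uB$, and similarly $\lambda x^0$ (adding $x$ to $\Omega$, type $A\to^0B$) and $\lambda x^1$ (adding $x$ to $\Delta$, type $A\to^1B$); from $\Gamma;\Omega;\Delta\vdash M\downarrow A\to^uB$ and $(\Gamma,\Delta);\Omega;\cdot\vdash N\Uparrow A$ infer $\Gamma;\Omega;\Delta\vdash MN^u\downarrow B$; from $\Gamma;\Omega;\Delta\vdash M\downarrow A\to^0B$ and $(\Gamma,\Omega,\Delta);\cdot;\cdot\vdash N\Uparrow A$ infer $\Gamma;\Omega;\Delta\vdash MN^0\downarrow B$; from $(\Gamma,\Delta_N);\Omega;\Delta_M\vdash M\downarrow A\to^1B$ and $(\Gamma,\Delta_M);\Omega;\Delta_N\vdash N\Uparrow A$ infer $\Gamma;\Omega;(\Delta_M,\Delta_N)\vdash MN^1\downarrow B$; and, for existential variables, $\Gamma;\cdot;\cdot\vdash F_B\,x_1^u\dots x_n^u\Uparrow a$ whenever $B=B_1\to^u\cdots\to^uB_n\to^ua$ and $x_1,\dots,x_n$ are distinct with $x_i{:}B_i\in\Gamma$. Translation: $(A\to B)^+=A^-\to^1B^+$,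 $(A\to B)^-=A^+\to^uB^-$, $a^+=a^-=a$. On terms: $(\lambda x{:}A.M)^-=\lambda x^u{:}A^+.M^-$; $(E_A\,x_1\dots x_n)^-=F_{A^-}\,x_1^u\dots x_n^u$ (one fresh $F_{A^-}$ per $E_A$); $M^-=M^+$ for other $M$ of atomic type; $x^+=x$, $c^+=c$, $(MN)^+=M^+\,(N^-)^1$. On contexts/signatures: $(\cdot)^+=\cdot$, $(\Gamma,x{:}A)^+=\Gamma^+,x{:}A^+$, $(\Sigma,a{:}\mathrm{type})^+=\Sigma^+,a{:}\mathrm{type}$, $(\Sigma,c{:}A)^+=\Sigma^+,c{:}A^+$. *)

(* Defs.v *)
(* Base types, constants and existential variables are
   named by natural numbers; term variables are de Bruijn indices, so that
   terms are identified up to renaming of bound variables and the variables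
   declared in a context are automatically distinct. *)
From Stdlib Require Import List.
Import ListNotations.

Inductive ty : Type :=
| Base (a : nat)
| Arr (A B : ty).

(* [Ex e A] is the existential variable E_A whose name is [e]. *)
Inductive tm : Type :=
| Cst (c : nat)
| Var (x : nat)
| Lam (A : ty) (M : tm)
| App (M N : tm)
| Ex (e : nat) (A : ty).

(* Signature declarations a : type and c : A, over a syntax [T] of types. *)
Inductive decl (T : Type) : Type :=
| DType (a : nat)
| DConst (c : nat) (A : T).
Arguments DType {T} a.
Arguments DConst {T} c A.

Definition signature (T : Type) : Type := list (decl T).

(* The variable with index [x] has the type at position [x]; the most recent
   declaration is the head of the list. *)
Definition ctx : Type := list ty.

Definition arrs (As : list ty) (B : ty) : ty := fold_right Arr B As.

Definition apps (M : tm) (Ns : list tm) : tm := fold_left App Ns M.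

Inductive can (S : signature ty) : ctx -> tm -> ty -> Prop :=
| can_atm G M a :
    atm S G M (Base a) ->
    can S G M (Base a)
| can_lam G A B M :
    can S (A :: G) M B ->
    can S G (Lam A M) (Arr A B)
| can_ex G e As a xs :
    NoDup xs ->
    Forall2 (fun x A => nth_error G x = Some A) xs As ->
    can S G (apps (Ex e (arrs As (Base a))) (map Var xs)) (Base a)
with atm (S : signature ty) : ctx -> tm -> ty -> Prop :=
| atm_cst G c A :
    In (DConst c A) S ->
    atm S G (Cst c) A
| atm_var G x A :
    nth_error G x = Some A ->
    atm S G (Var x) A
| atm_app G A B M N :
    atm S G M (Arr A B) ->
    can S G N A ->
    atm S G (App M N) B.

Inductive label : Type := L1 | L0 | Lu.

Inductive sty : Type :=
| SBase (a : nat)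
| SArr (k : label) (A B : sty).

(* [SApp M N k] is M N^k. *)
Inductive stm : Type :=
| SCst (c : nat)
| SVar (x : nat)
| SLam (k : label) (A : sty) (M : stm)
| SApp (M N : stm) (k : label)
| SEx (f : nat) (B : sty).

(* The three disjoint zones Gamma; Omega; Delta are one list in which every
   declaration carries the label of its zone: [Lu] for Gamma (unrestricted),
   [L0] for Omega (irrelevant), [L1] for Delta (strict). *)
Definition sctx : Type := list (label * sty).

(* Gamma; .; . *)
Definition unr (G : list sty) : sctx := map (pair Lu) G.

(* From Gamma; Omega; Delta to (Gamma, Delta); Omega; . *)
Definition relax_label (k : label) : label :=
  match k with L1 => Lu | L0 => L0 | Lu => Lu end.

Definition relax_strict (P : sctx) : sctx :=
  map (fun p => (relax_label (fst p), snd p)) P.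

(* From Gamma; Omega; Delta to (Gamma, Omega, Delta); .; . *)
Definition relax_all (P : sctx) : sctx := unr (map snd P).

Definition no_strict (P : sctx) : Prop := Forall (fun p => fst p <> L1) P.

(* [zsplit P PM PN]: if P is Gamma; Omega; (Delta_M, Delta_N), then PM is
   (Gamma, Delta_N); Omega; Delta_M and PN is (Gamma, Delta_M); Omega; Delta_N. *)
Inductive zsplit : sctx -> sctx -> sctx -> Prop :=
| zsplit_nil : zsplit [] [] []
| zsplit_unr A P PM PN :
    zsplit P PM PN -> zsplit ((Lu, A) :: P) ((Lu, A) :: PM) ((Lu, A) :: PN)
| zsplit_irr A P PM PN :
    zsplit P PM PN -> zsplit ((L0, A) :: P) ((L0, A) :: PM) ((L0, A) :: PN)
| zsplit_strict_l A P PM PN :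
    zsplit P PM PN -> zsplit ((L1, A) :: P) ((L1, A) :: PM) ((Lu, A) :: PN)
| zsplit_strict_r A P PM PN :
    zsplit P PM PN -> zsplit ((L1, A) :: P) ((Lu, A) :: PM) ((L1, A) :: PN).

Definition sarrs (k : label) (Bs : list sty) (B : sty) : sty :=
  fold_right (SArr k) B Bs.

Definition sapps (k : label) (M : stm) (Ns : list stm) : stm :=
  fold_left (fun M N => SApp M N k) Ns M.

Inductive scan (S : signature sty) : sctx -> stm -> sty -> Prop :=
| scan_atm P M a :
    satm S P M (SBase a) ->
    scan S P M (SBase a)
| scan_lam P k A B M :
    scan S ((k, A) :: P) M B ->
    scan S P (SLam k A M) (SArr k A B)
| scan_ex G f Bs a xs :
    NoDup xs ->
    Forall2 (fun x B => nth_error G x = Some B) xs Bs ->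
    scan S (unr G) (sapps Lu (SEx f (sarrs Lu Bs (SBase a))) (map SVar xs))
      (SBase a)
with satm (S : signature sty) : sctx -> stm -> sty -> Prop :=
| satm_cst P c A :
    no_strict P ->
    In (DConst c A) S ->
    satm S P (SCst c) A
| satm_var_unr P x A :
    no_strict P ->
    nth_error P x = Some (Lu, A) ->
    satm S P (SVar x) A
| satm_var_strict P x A :
    nth_error P x = Some (L1, A) ->
    (forall y B, nth_error P y = Some (L1, B) -> y = x) ->
    satm S P (SVar x) A
| satm_app_u P A B M N :
    satm S P M (SArr Lu A B) ->
    scan S (relax_strict P) N A ->
    satm S P (SApp M N Lu) B
| satm_app_0 P A B M N :
    satm S P M (SArr L0 A B) ->
    scan S (relax_all P) N A ->
    satm S P (SApp M N L0) B
| satm_app_1 P PM PN A B M N :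
    zsplit P PM PN ->
    satm S PM M (SArr L1 A B) ->
    scan S PN N A ->
    satm S P (SApp M N L1) B.

Fixpoint ty_pos (A : ty) : sty :=
  match A with
  | Base a => SBase a
  | Arr A B => SArr L1 (ty_neg A) (ty_pos B)
  end
with ty_neg (A : ty) : sty :=
  match A with
  | Base a => SBase a
  | Arr A B => SArr Lu (ty_pos A) (ty_neg B)
  end.

(* The clause (E_A x1 ... xn)^- = F_{A^-} x1^u ... xn^u, undefined on terms of
   any other form.  The name of E_A is reused for F_{A^-}: existential variables
   of the two calculi are syntactically distinct, and distinct E_A get distinct
   F_{A^-} because [ty_neg] is injective ([ty_neg_inj] below). *)
Fixpoint ex_neg (M : tm) : option stm :=
  match M with
  | Ex e A => Some (SEx e (ty_neg A))
  | App M (Var x) => option_map (fun M' => SApp M' (SVar x) Lu) (ex_neg M)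
  | _ => None
  end.

Definition sapp1 (oM oN : option stm) : option stm :=
  match oM, oN with
  | Some M, Some N => Some (SApp M N L1)
  | _, _ => None
  end.

(* M^+ and M^- are partial: M^+ is undefined on abstractions and on existential
   variables.  The clause M^- = M^+ for the remaining M is written out in
   [tm_neg], as the guard condition requires; see [tm_neg_atomic]. *)
Fixpoint tm_pos (M : tm) : option stm :=
  match M with
  | Cst c => Some (SCst c)
  | Var x => Some (SVar x)
  | App M N => sapp1 (tm_pos M) (tm_neg N)
  | Lam _ _ | Ex _ _ => None
  end
with tm_neg (M : tm) : option stm :=
  match M with
  | Lam A M => option_map (SLam Lu (ty_pos A)) (tm_neg M)
  | Cst c => Some (SCst c)
  | Var x => Some (SVar x)
  | Ex _ _ => ex_neg M
  | App M1 N =>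
      match ex_neg M with
      | Some M' => Some M'
      | None => sapp1 (tm_pos M1) (tm_neg N)
      end
  end.

Definition ctx_pos (G : ctx) : list sty := map ty_pos G.

Definition decl_pos (d : decl ty) : decl sty :=
  match d with
  | DType a => DType a
  | DConst c A => DConst c (ty_pos A)
  end.

Definition sig_pos (S : signature ty) : signature sty := map decl_pos S.

Lemma ty_pos_neg_inj A :
  (forall B, ty_pos A = ty_pos B -> A = B) /\
  (forall B, ty_neg A = ty_neg B -> A = B).
Proof.
  induction A as [a | A1 [IHp1 IHn1] A2 [IHp2 IHn2]];
    split; intros [b | B1 B2]; simpl; intros E; inversion E; f_equal; auto.
Qed.

Lemma ty_neg_inj A B : ty_neg A = ty_neg B -> A = B.
Proof. exact (proj2 (ty_pos_neg_inj A) B). Qed.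

Lemma tm_neg_atomic M :
  (forall A N, M <> Lam A N) -> ex_neg M = None -> tm_neg M = tm_pos M.
Proof.
  destruct M as [c | x | A N | M N | e A]; intros HL HE; try reflexivity.
  - now destruct (HL A N).
  - change (match ex_neg (App M N) with
            | Some M' => Some M'
            | None => sapp1 (tm_pos M) (tm_neg N)
            end = tm_pos (App M N)).
    now rewrite HE.
  - discriminate HE.
Qed.

Lemma ex_neg_apps e A xs :
  ex_neg (apps (Ex e A) (map Var xs)) =
  Some (sapps Lu (SEx e (ty_neg A)) (map SVar xs)).
Proof.
  induction xs as [| x xs IH] using rev_ind; [reflexivity |].
  unfold apps, sapps in *; rewrite !map_app, !fold_left_app; simpl.
  now rewrite IH.
Qed.

Lemma tm_neg_ex e A xs :
  tm_neg (apps (Ex e A) (map Var xs)) =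
  Some (sapps Lu (SEx e (ty_neg A)) (map SVar xs)).
Proof.
  rewrite <- ex_neg_apps.
  destruct xs as [| x xs _] using rev_ind; [reflexivity |].
  pose proof (ex_neg_apps e A (xs ++ [x])) as H; revert H.
  unfold apps; rewrite map_app, fold_left_app; simpl.
  now intros ->.
Qed.

(* Main.v *)
(** Over a purely unrestricted zone the strict context splits trivially, so a
    strict application can be typed with the same context on both sides. Hence
    every rule of the simply-typed system maps to one strict rule, and the
    theorem follows by mutual induction. The translation of a canonical term
    of base type is unambiguous because [M^+] is undefined on terms headed by
    an existential variable. *)
Require Import Defs.
From Stdlib Require Import List.

Scheme can_mut := Induction for can Sort Prop
  with atm_mut := Induction for atm Sort Prop.
Combined Scheme can_atm_ind from can_mut, atm_mut.

Lemma no_strict_unr G : no_strict (unr G).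
Proof. induction G; constructor; [discriminate | assumption]. Qed.

Lemma zsplit_unr_diag G : zsplit (unr G) (unr G) (unr G).
Proof. induction G; constructor; assumption. Qed.

Lemma nth_error_unr G x B :
  nth_error G x = Some B -> nth_error (unr G) x = Some (Lu, B).
Proof. exact (map_nth_error (pair Lu) x G (d := B)). Qed.

Lemma nth_error_ctx_pos G x A :
  nth_error G x = Some A -> nth_error (ctx_pos G) x = Some (ty_pos A).
Proof. exact (map_nth_error ty_pos x G (d := A)). Qed.

(** Argument types turn positive under [ty_neg], exactly as variable types do under [ctx_pos]; this
    makes the premises of [scan_ex] fit. *)
Lemma ty_neg_arrs As a :
  ty_neg (arrs As (Base a)) = sarrs Lu (map ty_pos As) (SBase a).
Proof. induction As as [| A As IH]; simpl; [| rewrite IH]; reflexivity. Qed.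

(** Both functions follow the application spine to its head: [ex_neg] succeeds only if the head is
    [Ex], where [tm_pos] fails. *)
Lemma tm_pos_ex_neg M M' : tm_pos M = Some M' -> ex_neg M = None.
Proof.
  revert M'; induction M as [c | x | A M _ | M IH N _ | e A];
    simpl; intros M' E; try discriminate; try reflexivity.
  destruct (tm_pos M) as [M1 |]; [| discriminate].
  destruct N; try reflexivity.
  now rewrite (IH M1).
Qed.

Lemma tm_pos_neg M M' : tm_pos M = Some M' -> tm_neg M = Some M'.
Proof.
  intros E; rewrite <- E; apply tm_neg_atomic.
  - intros A N ->; discriminate.
  - exact (tm_pos_ex_neg M M' E).
Qed.

Lemma can_atm_translation S :
  (forall G M A, can S G M A ->
     exists M', tm_neg M = Some M' /\
       scan (sig_pos S) (unr (ctx_pos G)) M' (ty_neg A)) /\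
  (forall G M A, atm S G M A ->
     exists M', tm_pos M = Some M' /\
       satm (sig_pos S) (unr (ctx_pos G)) M' (ty_pos A)).
Proof.
  apply can_atm_ind.
  - intros G M a _ (M' & E & H).
    exists M'; split; [now apply tm_pos_neg | now constructor].
  - intros G A B M _ (M' & E & H).
    exists (SLam Lu (ty_pos A) M'); simpl; rewrite E.
    split; [reflexivity | now constructor].
  - intros G e As a xs Hxs HA.
    eexists; split; [apply tm_neg_ex |].
    rewrite ty_neg_arrs; apply scan_ex; [assumption |].
    induction HA as [| x A xs As Hx _ IH]; constructor.
    + now apply nth_error_ctx_pos.
    (* [Hxs] was generalized with [xs], so [IH] asks for distinctness of the tail. *)
    + inversion Hxs; auto.
  - intros G c A Hc.
    exists (SCst c); split; [reflexivity |].
    apply satm_cst; [apply no_strict_unr |].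
    (* [decl_pos (DConst c A)] reduces to [DConst c (ty_pos A)]. *)
    exact (in_map decl_pos S (DConst c A) Hc).
  - intros G x A Hx.
    exists (SVar x); split; [reflexivity |].
    apply satm_var_unr; [apply no_strict_unr |].
    now apply nth_error_unr, nth_error_ctx_pos.
  - intros G A B M N _ (M' & EM & HM) _ (N' & EN & HN).
    exists (SApp M' N' L1); simpl; rewrite EM, EN.
    split; [reflexivity |].
    exact (satm_app_1 _ _ _ _ _ _ _ _ (zsplit_unr_diag _) HM HN).
Qed.

Theorem theorem5p4 (S : signature ty) (G : ctx) (M : tm) (A : ty) :
  (can S G M A ->
     exists M' : stm,
       tm_neg M = Some M' /\
       scan (sig_pos S) (unr (ctx_pos G)) M' (ty_neg A)) /\
  (atm S G M A ->
     exists M' : stm,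
       tm_pos M = Some M' /\
       satm (sig_pos S) (unr (ctx_pos G)) M' (ty_pos A)).
Proof.
  split; [apply (proj1 (can_atm_translation S)) | apply (proj2 (can_atm_translation S))].
Qed.
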